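(* Let $G=(V,K)$ be a connected, locally finite graph with infinite vertex set and maximal degree $B=\sup_{i\in V}B_i\in\mathbb N\cup\{\infty\}$, and let $\alpha\in\mathcal M_1(E)$ be a probability measure on $E=\{-1,0,1\}$. The hard-core Widom-Rowlinson specification $\gamma^{hc}_\alpha$ on $G$ satisfies Dobrushin's condition if and only if one of the following holds: (1) $B=1$ and $\alpha\notin\{\delta_1,\delta_{-1}\}$; (2) $2\le B<\infty$ and $\max\{\alpha(-1),\alpha(1)\}<\dfrac{\alpha(0)}{B-1}$; (3) $B=\infty$ and $\alpha(0)=1$.
   Context: $B_i$ is the degree of $i\in V$; $i\sim j$ means $\{i,j\}\in K$; $\Omega=E^V$; $\mathcal M_1(E)$ is the set of probability measures on $E$ and $\delta_a$ is the Dirac measure at $a$. The hard-core Widom-Rowlinson specification with a priori measure $\alpha$ is, for finite $\Lambda\subset V$, $\omega\in E^\Lambda$, $\eta\in E^{V\setminus\Lambda}$, $$\gamma^{hc}_{\Lambda,\alpha}(\omega|\eta)=\frac1{Z_\eta}\prod_{\{i,j\}\in K,\ \{i,j\}\cap\Lambda\neq\emptyset}\mathbf 1(\xi_i\xi_j\neq-1)\prod_{i\in\Lambda}\alpha(\omega_i),\qquad \xi=\omega_\Lambda\eta_{V\setminus\Lambda},$$ with $Z_\eta$ the normalization. For a specification $\gamma$ let $\gamma^0_i(\cdot|\eta)$ be the law on $E$ of the spin at $i$ under $\gamma_{\{i\}}(\cdot|\eta_{V\setminus\{i\}})$, and $$C_{ij}(\gamma)=\sup\{d_{TV}(\gamma^0_i(\cdot|\eta),\gamma_i^0(\cdot|\zeta)):\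 \eta,\zeta\in\Omega,\ \eta_{V\setminus\{j\}}=\zeta_{V\setminus\{j\}}\},$$ where $d_{TV}(\mu,\nu)=\frac12\sum_{a\in E}|\mu(a)-\nu(a)|$. The Dobrushin constant is $c(\gamma)=\sup_{i\in V}\sum_{j\in V}C_{ij}(\gamma)$. $\gamma$ satisfies Dobrushin's condition if $c(\gamma)<1$ and $\gamma$ is quasilocal, i.e. $\gamma_\Lambda(f|\cdot)$ is a uniform limit of local functions (functions depending on finitely many coordinates) whenever $f$ is, for every finite $\Lambda$. *)

(* Defs.v *)
From HB Require Import structures.
From mathcomp Require Import all_boot all_order all_algebra finmap.
From mathcomp Require Import all_classical all_reals all_analysis.

Set Implicit Arguments.
Unset Strict Implicit.
Unset Printing Implicit Defensive.

Import Order.TTheory GRing.Theory Num.Theory.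
Import numFieldNormedType.Exports.

Local Open Scope classical_set_scope.
Local Open Scope ring_scope.

(** ** Graphs *)

(* Edges are unordered pairs, so the graph is simple. *)
Record graph (V : choiceType) := Graph {
  edges : set {fset V};
  edges_card2 : forall e, edges e -> #|` e|%fset = 2%N }.

Definition adj (V : choiceType) (G : graph V) : rel V :=
  fun i j => `[< edges G [fset i; j]%fset >].

Definition nbh (V : choiceType) (G : graph V) (i : V) : set V :=
  [set j | adj G i j].

Definition locally_finite_graph (V : choiceType) (G : graph V) : Prop :=
  forall i, finite_set (nbh G i).

Definition connected_graph (V : choiceType) (G : graph V) : Prop :=
  forall i j, exists2 p : seq V, path (adj G) i p & last i p = j.

(* Meaningful when nbh G i is finite (fset_set is empty on infinite sets). *)
Definition degree (V : choiceType) (G : graph V) (i : V) : nat :=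
  #|` fset_set (nbh G i)|%fset.

Definition max_degree (R : realType) (V : choiceType) (G : graph V) : \bar R :=
  ereal_sup [set ((degree G i)%:R)%:E | i in [set: V]].

(** ** Kernels and Dobrushin's condition, for a finite single-spin space E *)

(* gamma L w eta stands for gamma_L(w | eta_{V \ L}): the boundary condition is
   given as a configuration on all of V, to be read off L only. *)
Definition kernels (R : realType) (V : choiceType) (E : finType) :=
  forall L : {fset V}, {ffun L -> E} -> (V -> E) -> R.

(* The configuration equal to w on L and to eta off L. *)
Definition glue_conf (V : choiceType) (E : finType) (L : {fset V})
    (w : {ffun L -> E}) (eta : V -> E) : V -> E :=
  fun v => if insub v is Some x then w x else eta v.

Section Kernels.
Context {R : realType} {V : choiceType} {E : finType}.
Implicit Types (gamma : kernels R V E) (eta zeta : V -> E).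

Definition kernel_act gamma (L : {fset V}) (f : (V -> E) -> R) :
    (V -> E) -> R :=
  fun eta => \sum_(w : {ffun L -> E}) f (glue_conf w eta) * gamma L w eta.

Definition single_site gamma (i : V) eta : E -> R :=
  fun a => \sum_(w : {ffun [fset i]%fset -> E} | w [` fset11 i]%fset == a)
    gamma [fset i]%fset w eta.

Definition dTV (mu nu : E -> R) : R := 2^-1 * \sum_(a : E) `|mu a - nu a|.

Definition interdependence gamma (i j : V) : \bar R :=
  ereal_sup [set x | exists eta zeta, (forall k, k != j -> eta k = zeta k) /\
    x = (dTV (single_site gamma i eta) (single_site gamma i zeta))%:E].

Definition dobrushin_constant gamma : \bar R :=
  ereal_sup [set \esum_(j in [set: V]) interdependence gamma i j
            | i in [set: V]].

Definition local_function (f : (V -> E) -> R) : Prop :=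
  exists D : {fset V}, forall eta zeta,
    (forall v, v \in D -> eta v = zeta v) -> f eta = f zeta.

Definition quasilocal_function (f : (V -> E) -> R) : Prop :=
  exists2 g : nat -> (V -> E) -> R,
    forall n, local_function (g n) & {uniform, g @ \oo --> f}.

Definition quasilocal gamma : Prop :=
  forall (L : {fset V}) (f : (V -> E) -> R),
    quasilocal_function f -> quasilocal_function (kernel_act gamma L f).

Definition dobrushin_condition gamma : Prop :=
  (dobrushin_constant gamma < 1)%E /\ quasilocal gamma.

End Kernels.

(** ** The spin space {-1, 0, 1} *)

Inductive spin : Type := spin_minus | spin_zero | spin_plus.

Definition spin_val (a : spin) : int :=
  match a with spin_minus => -1 | spin_zero => 0 | spin_plus => 1 end.

Definition spin_to_ord (a : spin) : 'I_3 :=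
  match a with spin_minus => inord 0 | spin_zero => inord 1 | spin_plus => inord 2 end.

Definition ord_to_spin (i : 'I_3) : spin :=
  match val i with 0%N => spin_minus | 1%N => spin_zero | _ => spin_plus end.

Lemma spin_to_ordK : cancel spin_to_ord ord_to_spin.
Proof. by case; rewrite /ord_to_spin /= inordK. Qed.

HB.instance Definition _ := Equality.copy spin (can_type spin_to_ordK).
HB.instance Definition _ := Choice.copy spin (can_type spin_to_ordK).
HB.instance Definition _ := Countable.copy spin (can_type spin_to_ordK).
HB.instance Definition _ := Finite.copy spin (can_type spin_to_ordK).
HB.instance Definition _ := isPointed.Build spin spin_zero.
HB.instance Definition _ := @isMeasurable.Build default_measure_display spin
  discrete_measurable discrete_measurable0
  discrete_measurableC discrete_measurableU.

(** ** The hard-core Widom-Rowlinson kernels *)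

Section HardCore.
Context {R : realType} {V : choiceType}.
Variables (G : graph V) (alpha : probability spin R).

Definition mass (a : spin) : R := fine (alpha [set a]).

Definition touching_edges (L : {fset V}) : set {fset V} :=
  [set e | edges G e /\ (e `&` L)%fset != fset0].

(* For e = {i, j} the inner product is xi_i xi_j. The outer product is over a
   finite set as soon as G is locally finite. *)
Definition hc_weight (L : {fset V}) (w : {ffun L -> spin}) (eta : V -> spin)
    : R :=
  (\big[*%R/(1 : R)]_(e \in touching_edges L)
     ((\prod_(i <- e) spin_val (glue_conf w eta i)) != -1)%:R : R)
  * \prod_(i : L) mass (w i).

(* The normalization vanishes for some eta when alpha(0) = 0; the quotient is
   then 0, by the convention x / 0 = 0. *)
Definition hc_spec : kernels R V spin := fun L w eta =>
  hc_weight w eta / \sum_(w' : {ffun L -> spin}) hc_weight w' eta.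

End HardCore.

(* Main.v *)
Require Import Defs.
From mathcomp Require Import all_boot all_order all_algebra finmap.
From mathcomp Require Import all_classical all_reals all_analysis.
From mathcomp Require Import ring lra.

Set Implicit Arguments.
Unset Strict Implicit.
Unset Printing Implicit Defensive.

Import Order.TTheory GRing.Theory Num.Theory.
Import numFieldNormedType.Exports.

Local Open Scope classical_set_scope.
Local Open Scope ring_scope.

(** Only the spin at a neighbour can influence the law at a site, so everything
    is read off the single-site laws.  With m, z, p the masses of -1, 0, 1, the
    conditional law at [i] is alpha conditioned on the spins not forbidden by
    the neighbours: a neighbour + forbids -, a neighbour - forbids +, and 0 is
    always allowed.  So it is one of four laws [site_law P M], indexed by
    whether + and - occur around [i] ([single_siteE]).

    Suppose z > 0.  Changing one neighbouring spin cannot lead from the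
    unconstrained law to the fully constrained one, and among all other pairs
    the largest distance is the one between the laws seeing only + and only -,
    [opposite_dTV] = max (p / (z + p), m / (z + m)) ([site_dTV_le],
    [opposite_dTVE]).  This distance is attained at each neighbour by a
    configuration vanishing elsewhere ([interdependence_ge]), so the
    Dobrushin constant is the supremum of the degrees times [opposite_dTV]
    ([dobrushin_constant_ge], [dobrushin_constant_le]).  For 1 < B < oo,
    B * [opposite_dTV] < 1 amounts to max (m, p) < z / (B - 1)
    ([opposite_dTV_lt1P]), and for B = oo finiteness of the constant forces
    [opposite_dTV] = 0, that is m = p = 0.

    If z = 0, the lower bound on the Dobrushin constant remains, with
    [opposite_dTV] at least 1/2, even though some of the laws may then be the
    zero function (an empty conditioning event).  An infinite connected graph
    has a vertex of degree at least 2 ([degree_ge2_exists]), so the constant is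
    at least 1; each of the alternatives (2) and (3) excludes z = 0.  The same
    vertex makes B = 1 impossible.

    Quasilocality always holds: the kernels have finite range
    ([hc_spec_quasilocal]). *)

(** * Uniform limits and finite-range kernels *)

Lemma uniform_cvg_normP (R : realType) (T : choiceType) (g : nat -> T -> R)
    (f : T -> R) :
  {uniform, g @ \oo --> f} <->
  forall e, 0 < e -> \forall n \near \oo, forall t, `|f t - g n t| <= e.
Proof.
split=> [gf e e0|gf].
  apply: (gf [set h | forall t, `|f t - h t| <= e]).
  apply/uniform_nbhs; exists [set xy : R * R | ball xy.1 e xy.2]; split.
    exact: entourage_ball (PosNum e0).
  by move=> h /= fh t; apply: ltW; exact: fh.
move=> P /uniform_nbhs [E [+ EP]].
rewrite -entourage_ballE => -[e /= e0 eE].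
have e20 : 0 < e / 2 by rewrite divr_gt0.
apply: filterS (gf _ e20) => n fg; apply: EP => t _; apply: eE => /=.
rewrite /ball /=; apply: le_lt_trans (fg t) _.
by rewrite ltr_pdivrMr // ltr_pMr // ltr1n.
Qed.

Section FiniteRange.
Context {R : realType} {V : choiceType} {E : finType}.
Implicit Types (gamma : kernels R V E) (D : {fset V}).

(** The kernel acts as a contraction in the sup norm and preserves local
    functions, hence preserves uniform limits of local functions.  The total
    mass is only bounded by 1 so as to cover a normalization that vanishes. *)
Lemma finite_range_quasilocal gamma :
  (forall L w eta, 0 <= gamma L w eta) ->
  (forall L eta, \sum_w gamma L w eta <= 1) ->
  (forall L, exists D, forall w eta zeta,
    (forall v, v \in D -> eta v = zeta v) ->
    gamma L w eta = gamma L w zeta) ->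
  quasilocal gamma.
Proof.
move=> gamma_ge0 gamma_le1 gamma_loc L f [g g_loc /uniform_cvg_normP gf].
have [D gammaD] := gamma_loc L.
exists (fun n => kernel_act gamma L (g n)) => [n|].
  have [D' gD'] := g_loc n; exists (D `|` D')%fset => eta zeta agree.
  apply: eq_bigr => w _; congr (_ * _).
    apply: gD' => v vD'; rewrite /glue_conf; case: insub => //.
    by apply: agree; rewrite inE vD' orbT.
  by apply: gammaD => v vD; apply: agree; rewrite inE vD.
apply/uniform_cvg_normP => e e0; apply: filterS (gf _ e0) => n fg eta.
rewrite /kernel_act -sumrB.
under eq_bigr do rewrite -mulrBl.
apply: le_trans (ler_norm_sum _ _ _) _.
apply: (@le_trans _ _ (\sum_w e * gamma L w eta)).
  apply: ler_sum => w _; rewrite normrM (ger0_norm (gamma_ge0 _ _ _)).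
  by rewrite ler_wpM2r.
by rewrite -mulr_sumr -[leRHS]mulr1 ler_wpM2l // ltW.
Qed.

End FiniteRange.

(** * Graphs *)

Section Graph.
Context {V : choiceType} (G : graph V).

Lemma adj_sym i j : adj G i j = adj G j i.
Proof. by rewrite /adj fsetUC. Qed.

Lemma adj_neq i j : adj G i j -> i != j.
Proof. by move=> /asboolP /edges_card2; rewrite cardfs2; case: eqP. Qed.

Lemma touching_edgeP (L : {fset V}) e : touching_edges G L e <->
  exists i j, [/\ i \in L, adj G i j & e = [fset i; j]%fset].
Proof.
split=> [[Ge /fset0Pn [i]]|[i [j [iL /asboolP Gij ->]]]]; last first.
  by split=> //; apply/fset0Pn; exists i; rewrite !inE eqxx.
rewrite inE => /andP[ie iL].
have /cardfs1P[j eij] : #|` (e `\ i)|%fset == 1%N.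
  by have := edges_card2 Ge; rewrite (cardfsD1 i) ie => /succn_inj ->.
exists i, j; suff ee : e = [fset i; j]%fset by split; rewrite // /adj -ee; apply/asboolP.
by rewrite -eij fsetD1K.
Qed.

Lemma finite_touching_edges : locally_finite_graph G ->
  forall L : {fset V}, finite_set (touching_edges G L).
Proof.
move=> Gfin L.
apply: (@sub_finite_set _ _
  (\bigcup_(i in [set` L]) ((fun j => [fset i; j]%fset) @` nbh G i))).
  by move=> e /touching_edgeP [i [j [iL Gij ->]]]; exists i => //; exists j.
apply: bigcup_finite => [|i _]; first exact: finite_fset.
by apply: finite_image; exact: Gfin.
Qed.

(** If all degrees were at most 1, a vertex together with its neighbourhood
    would be closed under adjacency, so connectedness would make the whole
    vertex set finite. *)
Lemma degree_ge2_exists : infinite_set [set: V] -> connected_graph G ->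
  locally_finite_graph G -> exists k, (2 <= degree G k)%N.
Proof.
move=> Vinf Gconn Gfin; apply: contrapT => noge2; apply: Vinf.
have [[i _]|noV] := pselect (exists i : V, True); last first.
  rewrite (_ : [set: V] = set0) //; apply/seteqP; split => // i _.
  by apply: noV; exists i.
have uniq_nbh j k l : adj G j k -> adj G j l -> k = l.
  move=> jk jl; apply/eqP/negPn/negP => kl; apply: noge2; exists j.
  rewrite /degree -(_ : #|` [fset k; l]|%fset = 2%N); last by rewrite cardfs2 kl.
  apply/fsubset_leq_card/fsubsetP => x; rewrite !inE in_fset_set ?inE //.
  by case/orP => /eqP ->.
apply: (@sub_finite_set _ _ ([set i] `|` nbh G i)); last first.
  by rewrite finite_setU; split => //; exact: Gfin.
move=> j _; have [p ip <-] := Gconn i j.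
have closed x y : ([set i] `|` nbh G i) x -> adj G x y ->
    ([set i] `|` nbh G i) y.
  move=> [-> xy|ix xy]; first by right.
  by left; apply: uniq_nbh xy _; rewrite adj_sym.
have closed_path q : forall x, ([set i] `|` nbh G i) x -> path (adj G) x q ->
    ([set i] `|` nbh G i) (last x q).
  elim: q => //= y q IH x xS /andP[xy yq].
  by apply: IH yq; exact: closed xy.
by apply: closed_path ip; left.
Qed.

End Graph.

(** * The a priori measure and quasilocality of the hard-core kernels *)

Section HardCoreKernel.
Context {R : realType} {V : choiceType} (G : graph V).
Variable alpha : probability spin R.

Lemma big_spin (F : spin -> R) :
  \sum_a F a = F spin_minus + F spin_zero + F spin_plus.
Proof.
rewrite (bigD1 spin_minus) // (bigD1 spin_zero) /=; last exact/eqP.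
rewrite (bigD1 spin_plus) /=; last by apply/andP; split; exact/eqP.
by rewrite big1 ?addr0 ?addrA // => -[] /andP[/andP[]] /eqP + /eqP + /eqP.
Qed.

Lemma mass_ge0 a : 0 <= mass alpha a.
Proof. by rewrite /mass fine_ge0. Qed.

Lemma sum_mass : mass alpha spin_minus + mass alpha spin_zero
  + mass alpha spin_plus = 1.
Proof.
have massE a : alpha [set a] = (mass alpha a)%:E by rewrite /mass fineK // fin_num_measure.
suff : (mass alpha spin_minus + mass alpha spin_zero + mass alpha spin_plus)%:E
    = 1%E :> \bar R by case.
rewrite !EFinD -!massE -(probability_setT alpha).
rewrite (_ : setT = [set spin_minus] `|` [set spin_zero] `|` [set spin_plus]).
  have disj : [set spin_minus] `&` [set spin_zero] = set0.
    by apply/seteqP; split => // a [/= ->].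
  have disj' : ([set spin_minus] `|` [set spin_zero]) `&` [set spin_plus] = set0.
    by apply/seteqP; split => // a [/= [] ->].
  by rewrite !measureU.
apply/seteqP; split => //; move=> a _; case: a; [by left; left|by left; right|by right].
Qed.

Lemma hc_weight_ge0 L w eta : 0 <= hc_weight G alpha (L := L) w eta.
Proof.
apply: mulr_ge0; last by apply: prodr_ge0 => i _; exact: mass_ge0.
by elim/big_ind : _ => // x y; exact: mulr_ge0.
Qed.

Lemma hc_spec_ge0 L w eta : 0 <= hc_spec G alpha (L := L) w eta.
Proof.
by rewrite divr_ge0 ?hc_weight_ge0 // sumr_ge0 // => w' _; exact: hc_weight_ge0.
Qed.

Lemma sum_hc_spec_le1 L eta : \sum_w hc_spec G alpha (L := L) w eta <= 1.
Proof. rewrite -mulr_suml; set Z := (X in X / X).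
by have [->|Z0] := eqVneq Z 0; rewrite ?mul0r ?divff. Qed.

Lemma hc_spec_local : locally_finite_graph G -> forall L : {fset V}, exists D : {fset V},
  forall (w : {ffun L -> spin}) eta zeta,
  (forall v, v \in D -> eta v = zeta v) ->
  hc_spec G alpha w eta = hc_spec G alpha w zeta.
Proof.
move=> Gfin L.
pose N := (fset_set (\bigcup_(i in [set` L]) nbh G i)).
exists N => w eta zeta agree.
have gluew w' j : j \in L \/ j \in N ->
    glue_conf (L := L) w' eta j = glue_conf w' zeta j.
  rewrite /glue_conf; case: insubP => // /negPf -> [//|]; exact: agree.
have weightw w' : hc_weight G alpha (L := L) w' eta = hc_weight G alpha w' zeta.
  congr (_ * _); apply: eq_fsbigr => e.
  rewrite inE => /touching_edgeP [i [j [iL ij ->]]].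
  suff -> : \prod_(k <- [fset i; j]%fset) spin_val (glue_conf w' eta k)
      = \prod_(k <- [fset i; j]%fset) spin_val (glue_conf w' zeta k) by [].
  apply: eq_big_seq => k; rewrite !inE => /orP kij; rewrite gluew //.
  case: kij => /eqP ->; [by left|right].
  rewrite in_fset_set; first by rewrite inE; exists i.
  by apply: bigcup_finite => // ? _; exact: Gfin.
by rewrite /hc_spec weightw; congr (_ / _); apply: eq_bigr => w' _.
Qed.

Lemma hc_spec_quasilocal :
  locally_finite_graph G -> quasilocal (hc_spec G alpha).
Proof.
by move=> Gfin; apply: finite_range_quasilocal => *;
  [exact: hc_spec_ge0|exact: sum_hc_spec_le1|exact: hc_spec_local].
Qed.

End HardCoreKernel.

(** * Single-site conditional laws *)

Section SingleSite.
Context {R : realType} {V : choiceType} (G : graph V).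
Variable alpha : probability spin R.

Local Notation m := (mass alpha spin_minus).
Local Notation z := (mass alpha spin_zero).
Local Notation p := (mass alpha spin_plus).

(** [P] and [M] record whether the spins + and - occur among the neighbours;
    + rules out - at the site, and conversely. *)
Definition site_weight (P M : bool) (a : spin) : R :=
  match a with
  | spin_minus => if P then 0 else m
  | spin_zero => z
  | spin_plus => if M then 0 else p
  end.

Definition site_law (P M : bool) (a : spin) : R :=
  site_weight P M a / \sum_b site_weight P M b.

Definition sees (i : V) (eta : V -> spin) (s : spin) : bool :=
  `[< exists2 j, adj G i j & eta j = s >].

Lemma prod_indicator (T : choiceType) (A : set T) (b : pred T) :
  finite_set A ->
  \big[*%R/(1 : R)]_(e \in A) (b e)%:R = `[< forall e, A e -> b e >]%:R.
Proof.
move=> Afin; rewrite fsbig_finite //; case: asboolP => [allb|/existsNP[e]].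
  by rewrite big1_seq // => e /=; rewrite in_fset_set // inE => /allb ->.
move=> /not_implyP [Ae /negP/negPf nbe].
rewrite (big_rem e) /= ?nbe ?mul0r //.
by rewrite in_fset_set // inE.
Qed.

Lemma sum_fset1_ffun (i : V) (F : spin -> R) (Q : pred spin) :
  \sum_(w : {ffun [fset i]%fset -> spin} | Q (w [` fset11 i]%fset))
    F (w [` fset11 i]%fset) = \sum_(a | Q a) F a.
Proof.
rewrite (reindex (fun a => [ffun=> a] : {ffun [fset i]%fset -> spin})) /=.
  by under eq_bigl do rewrite ffunE; under eq_bigr do rewrite ffunE.
exists (fun w => w [` fset11 i]%fset) => [a _|w _]; first by rewrite ffunE.
apply/ffunP => x; rewrite ffunE; congr (w _); apply: val_inj => /=.
by apply/esym/fset1P; exact: valP.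
Qed.

Lemma spin_mul_minus s :
  (spin_val spin_minus * spin_val s != -1) = (s != spin_plus).
Proof. by case: s; rewrite ?eqxx //; apply/esym/eqP. Qed.

Lemma spin_mul_plus s :
  (spin_val spin_plus * spin_val s != -1) = (s != spin_minus).
Proof. by case: s; rewrite ?eqxx //; apply/esym/eqP. Qed.

Hypothesis Gfin : locally_finite_graph G.

(** An edge between [i] and [j] forbids nothing but the values -1 of the
    product of the two spins, so the weight factors through [sees]. *)
Lemma hc_weight_site i (w : {ffun [fset i]%fset -> spin}) eta :
  hc_weight G alpha w eta =
  site_weight (sees i eta spin_plus) (sees i eta spin_minus)
    (w [` fset11 i]%fset).
Proof.
set a := w _.
have -> : hc_weight G alpha w eta =
    `[< forall j, adj G i j -> spin_val a * spin_val (eta j) != -1 >]%:R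
    * mass alpha a.
  rewrite /hc_weight prod_indicator; last exact: finite_touching_edges.
  congr (_ * _); last first.
    rewrite (bigD1 [` fset11 i]%fset) //= big1 ?mulr1 // => x /eqP[].
    by apply: val_inj => /=; apply/fset1P; exact: valP.
  have edgeE j : adj G i j ->
      \prod_(k <- [fset i; j]%fset) spin_val (glue_conf w eta k)
      = spin_val a * spin_val (eta j).
    move=> ij; rewrite big_fsetU1 /=; last by rewrite inE (adj_neq ij).
    rewrite big_seq_fset1 /glue_conf; congr (spin_val _ * spin_val _).
      case: insubP => [x _ xi|]; last by rewrite fset11.
      by congr (w _); exact: val_inj.
    case: insubP => // x; rewrite inE => /eqP ji.
    by move/adj_neq: ij; rewrite ji eqxx.
  congr ((nat_of_bool _)%:R); apply: asbool_equiv_eq; split => [H j ij|H e].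
    rewrite -edgeE //; apply: H; apply/touching_edgeP; exists i, j.
    by rewrite fset11.
  move=> /touching_edgeP [k [j [/fset1P -> ij ->]]].
  by rewrite edgeE //; exact: H.
have zeroP s : `[< forall j, adj G i j -> eta j != s >] = ~~ sees i eta s.
  rewrite /sees -asbool_neg; apply: asbool_equiv_eq; split.
    by move=> H [j /H/eqP].
  by move=> H j ij; apply/eqP => es; apply: H; exists j.
have aE : `[< forall j, adj G i j -> spin_val a * spin_val (eta j) != -1 >] =
    match a with
    | spin_minus => ~~ sees i eta spin_plus
    | spin_zero => true
    | spin_plus => ~~ sees i eta spin_minus
    end.
  case: (a); rewrite -?zeroP.
  - by apply: asbool_equiv_eq; split=> H j /H; rewrite spin_mul_minus.
  - by apply/asboolP => j _; case: (eta j).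
  - by apply: asbool_equiv_eq; split=> H j /H; rewrite spin_mul_plus.
rewrite aE; case: (a); rewrite /= ?mul1r //;
  by case: sees; rewrite ?mul1r ?mul0r.
Qed.

Lemma single_siteE i eta :
  single_site (hc_spec G alpha) i eta =
  site_law (sees i eta spin_plus) (sees i eta spin_minus).
Proof.
apply/funext => a; rewrite /single_site /hc_spec.
under eq_bigr do rewrite hc_weight_site.
rewrite -mulr_suml (sum_fset1_ffun i _ (pred1 a)) big_pred1_eq.
congr (_ / _); under eq_bigr do rewrite hc_weight_site.
exact: (sum_fset1_ffun i _ predT).
Qed.

End SingleSite.

(** * Total variation distances between the single-site laws *)

Section TotalVariation.
Context {R : realType}.
Variable alpha : probability spin R.

Local Notation m := (mass alpha spin_minus).
Local Notation z := (mass alpha spin_zero).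
Local Notation p := (mass alpha spin_plus).
(* The conditional masses of + given {0, +} and of - given {-, 0}. *)
Local Notation u := (p / (z + p)).
Local Notation v := (m / (z + m)).

(** The distance between the laws at a site that sees only + and one that sees
    only -, the influence of a neighbour when all others are 0. *)
Definition opposite_dTV : R :=
  dTV (site_law alpha true false) (site_law alpha false true).

Lemma dTV_spinE (mu nu : spin -> R) : dTV mu nu =
  2^-1 * (`|mu spin_minus - nu spin_minus| + `|mu spin_zero - nu spin_zero|
          + `|mu spin_plus - nu spin_plus|).
Proof. by rewrite /dTV big_spin. Qed.

Lemma opposite_dTV_ge0 : 0 <= opposite_dTV.
Proof. by rewrite mulr_ge0 // sumr_ge0. Qed.

Lemma dTVxx (mu : spin -> R) : dTV mu mu = 0.
Proof. by rewrite dTV_spinE !subrr !normr0 !addr0 mulr0. Qed.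

(** The two laws live on the disjoint sets {+} and {-}, and at least one of
    them has mass 1; the other is the zero function when m or p vanishes, hence
    only 1/2. *)
Lemma opposite_dTV_ge_half : z = 0 -> 2^-1 <= opposite_dTV.
Proof.
move=> z0; have := sum_mass alpha; have := mass_ge0 alpha spin_minus.
have := mass_ge0 alpha spin_plus.
rewrite /opposite_dTV dTV_spinE /site_law !big_spin /= z0 !add0r !addr0.
rewrite !mul0r subrr normr0 addr0 sub0r subr0 normrN.
have [->|m0] := eqVneq m 0.
  rewrite !add0r !mul0r normr0 add0r => _ _ p1.
  by rewrite p1 divr1 normr1 mulr1.
rewrite (divff m0) normr1 => _ _ _.
by rewrite ler_peMr ?invr_ge0 // lerDl.
Qed.

Hypothesis z_gt0 : 0 < z.

(** Conditioning on {0, +} increases the mass of + by u m, hence by at most m;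
    likewise for -. *)
Lemma cond_mass_bounds :
  [/\ p <= u, m <= v, u - p <= m & v - m <= p] /\ (u <= 1 /\ v <= 1).
Proof.
have := sum_mass alpha; have := mass_ge0 alpha spin_minus.
have := mass_ge0 alpha spin_plus => p0 m0 mzp.
have zp0 : 0 < z + p by rewrite ltr_wpDr.
have zm0 : 0 < z + m by rewrite ltr_wpDr.
have uE : u * (z + p) = p by rewrite divfK // gt_eqF.
have vE : v * (z + m) = m by rewrite divfK // gt_eqF.
have u0 : 0 <= u by rewrite divr_ge0 // ltW.
have v0 : 0 <= v by rewrite divr_ge0 // ltW.
have u1 : u <= 1 by rewrite ler_pdivrMr // mul1r lerDr ltW.
have v1 : v <= 1 by rewrite ler_pdivrMr // mul1r lerDr ltW.
split=> //; move: u v uE vE u0 v0 u1 v1 => a b uE vE u0 v0 u1 v1.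
move: m z p z_gt0 mzp p0 m0 zp0 zm0 uE vE => x y t *.
split; nra.
Qed.

Lemma site_lawE P M :
  [/\ site_law alpha P M spin_minus = if P then 0 else if M then v else m,
      site_law alpha P M spin_zero =
        1 - (if P then 0 else if M then v else m)
          - (if M then 0 else if P then u else p) &
      site_law alpha P M spin_plus = if M then 0 else if P then u else p].
Proof.
have zp0 : z + p != 0 by rewrite gt_eqF // ltr_wpDr // mass_ge0.
have zm0 : z + m != 0 by rewrite gt_eqF // ltr_wpDr // mass_ge0.
have mz0 : m + z != 0 by rewrite addrC.
have z0 : z != 0 by rewrite gt_eqF.
rewrite /site_law big_spin; case: P M => [] [] /=.
- by rewrite add0r addr0 !subr0 mul0r divff.
- by rewrite add0r mul0r subr0; split => //; field.
- by rewrite addr0 mul0r subr0 (addrC m); split => //; field.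
by rewrite sum_mass !divr1 -(sum_mass alpha); split => //; ring.
Qed.

Lemma opposite_dTVE : opposite_dTV = Num.max u v.
Proof.
have [tm tz tp] := site_lawE true false; have [fm fz fp] := site_lawE false true.
have [[pu mv _ _] [u1 v1]] := cond_mass_bounds.
have p0 := mass_ge0 alpha spin_plus; have m0 := mass_ge0 alpha spin_minus.
rewrite /opposite_dTV dTV_spinE tm tz tp fm fz fp.
move: u v pu mv u1 v1 {tm tz tp fm fz fp} => a b *.
by case: (leP a b) => ?; do ?case: ger0P => ?; lra.
Qed.

(** The compatibility hypothesis excludes exactly the pair formed by the
    unconstrained law and the fully constrained one, at distance m + p, which
    may be larger than [opposite_dTV]. *)
Lemma site_dTV_le P M P' M' : (P = M -> P' = M' -> P = P') ->
  dTV (site_law alpha P M) (site_law alpha P' M') <= opposite_dTV.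
Proof.
rewrite opposite_dTVE dTV_spinE => compat.
have [lm lz lp] := site_lawE P M; have [rm rz rp] := site_lawE P' M'.
rewrite lm lz lp rm rz rp {lm lz lp rm rz rp}.
have [[pu mv up vm] [u1 v1]] := cond_mass_bounds.
have p0 := mass_ge0 alpha spin_plus; have m0 := mass_ge0 alpha spin_minus.
have uc : u <= Num.max u v by rewrite le_max lexx.
have vc : v <= Num.max u v by rewrite le_max lexx orbT.
move: (Num.max u v) uc vc => c uc vc.
move: m z p u v pu mv up vm u1 v1 p0 m0 z_gt0 uc vc => x y t a b *.
case: P M P' M' compat => [] [] [] [] compat;
  try (by have := compat erefl erefl);
  rewrite ?subrr ?normr0; do ?case: ger0P => ?; lra.
Qed.

End TotalVariation.

(** * The Dobrushin constant *)

Section DobrushinConstant.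
Context {R : realType} {V : choiceType} (G : graph V).
Variable alpha : probability spin R.
Hypothesis Gfin : locally_finite_graph G.

Lemma sees_split i j eta s : adj G i j ->
  sees G i eta s =
  `[< exists2 k, adj G i k /\ k != j & eta k = s >] || (eta j == s).
Proof.
move=> ij; apply/asboolP/orP => [[k ik ks]|[/asboolP[k [ik _] ks]|/eqP js]].
- have [kj|kj] := eqVneq k j; first by right; rewrite -kj ks.
  by left; apply/asboolP; exists k.
- by exists k.
- by exists j.
Qed.

Lemma eq_sees i j eta zeta s : (forall k, k != j -> eta k = zeta k) ->
  ~~ adj G i j -> sees G i eta s = sees G i zeta s.
Proof.
move=> agree /negP nij; apply: asbool_equiv_eq.
have neq k : adj G i k -> k != j by apply: contraTneq => ->; exact/negP.
by split => -[k ik <-]; exists k => //; rewrite agree ?neq.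
Qed.

(** Putting + or - at [j] and 0 everywhere else produces the two laws compared
    in [opposite_dTV]. *)
Lemma interdependence_ge i j : adj G i j ->
  ((opposite_dTV alpha)%:E <= interdependence (hc_spec G alpha) i j)%E.
Proof.
move=> ij; apply: ereal_sup_ubound.
pose only s k := if k == j then s else spin_zero.
have sees_only s t : s != spin_zero -> t != spin_zero -> sees G i (only s) t = (s == t).
  move=> s0 t0; rewrite (sees_split _ _ ij) /only eqxx.
  rewrite (_ : `[< _ >] = false) //; apply/asboolPn => -[k [_ /negPf ->]] t0'.
  by rewrite t0' eqxx in t0.
exists (only spin_plus), (only spin_minus); split.
  by move=> k /negPf kj; rewrite /only kj.
rewrite !single_siteE // !sees_only ?eqxx //; try exact/eqP.
by do 2 ![rewrite (_ : (_ == _) = false); last exact/eqP].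
Qed.

(** If a neighbour other than [j] carries a nonzero spin, then it constrains
    both laws; otherwise the single spin at [j] cannot provide both signs, so
    neither law is fully constrained.  In both cases [site_dTV_le] applies. *)
Lemma interdependence_le i j : 0 < mass alpha spin_zero ->
  (interdependence (hc_spec G alpha) i j <=
   (if j \in nbh G i then opposite_dTV alpha else 0)%:E)%E.
Proof.
move=> z0; apply: ge_ereal_sup => _ [eta [zeta [agree ->]]].
rewrite lee_fin !single_siteE //; case: ifPn => [|nij]; last first.
  have nadj : ~~ adj G i j by apply: contra nij; rewrite inE.
  by rewrite !(eq_sees _ agree nadj) dTVxx.
rewrite inE => ij; apply: site_dTV_le => //.
rewrite !(sees_split _ _ ij).
have same s : `[< exists2 k, adj G i k /\ k != j & zeta k = s >]
    = `[< exists2 k, adj G i k /\ k != j & eta k = s >].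
  by apply: asbool_equiv_eq; split=> -[k [ik kj] <-]; exists k; rewrite ?agree.
have excl s : ((s == spin_plus) = (s == spin_minus)) -> s = spin_zero.
  by case: s => //; rewrite eqxx => H; first [by move/eqP: H|by move/esym/eqP: H].
rewrite !same; do 2!case: asboolP => _ //=; last by move=> /excl -> /excl ->.
by move=> -> ->.
Qed.

Lemma sum_nbh i (c : R) :
  (\sum_(j \in nbh G i) c%:E = ((degree G i)%:R * c)%:E)%E.
Proof.
rewrite fsbig_finite //.
by rewrite sumEFin big_const_seq count_predT iter_addr_0 mulr_natl.
Qed.

Lemma dobrushin_constant_ge i :
  (((degree G i)%:R * opposite_dTV alpha)%:E <=
   dobrushin_constant (hc_spec G alpha))%E.
Proof.
apply: le_trans (ereal_sup_ubound _); last by exists i.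
apply: esum_ge; exists (nbh G i); first by split; [exact: Gfin|].
by rewrite -sum_nbh; apply: lee_fsum => // j; exact: interdependence_ge.
Qed.

Lemma dobrushin_constant_le (b : R) : 0 < mass alpha spin_zero ->
  (forall i, (degree G i)%:R * opposite_dTV alpha <= b) ->
  (dobrushin_constant (hc_spec G alpha) <= b%:E)%E.
Proof.
move=> z0 degb; apply: ge_ereal_sup => _ [i _ <-].
apply: (@le_trans _ _ (((degree G i)%:R * opposite_dTV alpha)%:E)); last first.
  by rewrite lee_fin.
apply: le_trans (le_esum (fun j _ => interdependence_le i j z0)) _.
rewrite -sum_nbh -[leRHS]esum_fset //; last first.
  by move=> j _; rewrite lee_fin opposite_dTV_ge0.
by rewrite [leRHS]esum_mkcond; apply: le_esum => j _; case: ifP.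
Qed.

End DobrushinConstant.

(** * Dobrushin's condition in terms of the maximal degree *)

Section MaximalDegree.
Context {R : realType} {V : choiceType} (G : graph V).
Variable alpha : probability spin R.

Lemma degree_le_max_degree i : ((degree G i)%:R%:E <= max_degree R G)%E.
Proof. by apply: ereal_sup_ubound; exists i. Qed.

(** b x / (z + x) < 1 says (b - 1) x < z, applied to x = m and x = p. *)
Lemma opposite_dTV_lt1P (b : R) : 1 < b -> 0 < mass alpha spin_zero ->
  b * opposite_dTV alpha < 1 <->
  Num.max (mass alpha spin_minus) (mass alpha spin_plus)
    < mass alpha spin_zero / (b - 1).
Proof.
move=> b1 z0; rewrite opposite_dTVE //.
have b0 : 0 < b by exact: lt_trans b1.
have main (x : R) : 0 <= x -> (b * (x / (mass alpha spin_zero + x)) < 1)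
    = (x < mass alpha spin_zero / (b - 1)).
  move=> x0; have zx0 : 0 < mass alpha spin_zero + x by rewrite ltr_wpDr.
  rewrite mulrA ltr_pdivrMr // mul1r ltr_pdivlMr ?subr_gt0 //.
  by rewrite mulrBr mulr1 ltrBlDr mulrC.
by rewrite maxr_pMr ?ltW // !gt_max !main ?mass_ge0 // andbC.
Qed.

End MaximalDegree.

Theorem theorem2p6 (R : realType) (V : choiceType) (G : graph V)
  (V_infinite : infinite_set [set: V])
  (G_connected : connected_graph G)
  (G_locally_finite : locally_finite_graph G)
  (alpha : probability spin R) :
  let B := max_degree R G in
  dobrushin_condition (hc_spec G alpha) <->
  [\/ [/\ B = 1%:E,
          alpha <> \d_spin_plus :> (set spin -> \bar R) &
          alpha <> \d_spin_minus :> (set spin -> \bar R)],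
      ((2%:E <= B)%E /\ (B < +oo)%E) /\
        Num.max (mass alpha spin_minus) (mass alpha spin_plus)
          < mass alpha spin_zero / (fine B - 1) |
      B = +oo%E /\ mass alpha spin_zero = 1].
Proof.
move=> B; set c := opposite_dTV alpha.
have c_ge0 : 0 <= c by exact: opposite_dTV_ge0.
have [k k2] := degree_ge2_exists V_infinite G_connected G_locally_finite.
have k2R : 2 <= (degree G k)%:R :> R by rewrite ler_nat.
have B2 : (2%:E <= B)%E.
  by apply: le_trans (degree_le_max_degree G k); rewrite lee_fin.
have B1 : B <> 1%:E.
  by move=> B1; move: B2; rewrite B1 lee_fin lern1.
have Bfin : (B < +oo)%E -> B = (fine B)%:E.
  by move=> Boo; rewrite fineK // fin_real // Boo andbT (lt_le_trans _ B2) // ltNyr.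
split.
  move=> [cst_lt1 _]; have degc i := dobrushin_constant_ge alpha G_locally_finite i.
  rewrite -/c in degc; move: cst_lt1 degc.
  case: (dobrushin_constant _) => [C| |] //; last by move=> _ /(_ k).
  rewrite lte_fin => C1 degC.
  have {}degC i : (degree G i)%:R * c <= C by rewrite -lee_fin.
  (* Otherwise the vertex [k] contributes at least 2 * 1/2 to the constant. *)
  have z0 : 0 < mass alpha spin_zero.
    rewrite lt_neqAle mass_ge0 andbT eq_sym; apply/eqP => z0.
    have := opposite_dTV_ge_half z0; rewrite -/c => c_half.
    have := degC k; nra.
  have BC : 0 < c -> (B <= (C / c)%:E)%E.
    move=> c0; apply: ge_ereal_sup => _ [i _ <-].
    by rewrite lee_fin ler_pdivlMr.
  have [Boo|Boo] := ltP B +oo%E.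
    apply: Or32; split => //.
    have b2 : 2 <= fine B by rewrite -lee_fin -Bfin.
    apply/opposite_dTV_lt1P => //; first by apply: lt_le_trans b2; rewrite ltr1n.
    rewrite -/c; move: c_ge0; rewrite le_eqVlt => /orP[/eqP <-|c0].
      by rewrite mulr0.
    apply: le_lt_trans C1; rewrite -ler_pdivlMr // -lee_fin -Bfin //.
    exact: BC.
  apply: Or33; move: Boo; rewrite leye_eq => /eqP Boo; split => //.
  have c0 : c = 0.
    apply/eqP; rewrite eq_le c_ge0 andbT leNgt; apply/negP => /BC.
    by rewrite Boo.
  have [[pu mv _ _] _] := cond_mass_bounds z0.
  have : Num.max (mass alpha spin_plus / (mass alpha spin_zero + mass alpha spin_plus))
     (mass alpha spin_minus / (mass alpha spin_zero + mass alpha spin_minus)) <= 0.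
    by rewrite -opposite_dTVE // -/c c0.
  rewrite ge_max => /andP[u0 v0].
  have p0 : mass alpha spin_plus = 0.
    by apply/eqP; rewrite eq_le mass_ge0 (le_trans pu u0).
  have m0 : mass alpha spin_minus = 0.
    by apply/eqP; rewrite eq_le mass_ge0 (le_trans mv v0).
  by have := sum_mass alpha; rewrite p0 m0 add0r addr0.
move=> RHS; split; last exact: hc_spec_quasilocal.
case: RHS => [[] //|[[_ Boo] maxlt]|[Boo z1]].
- have b2 : 2 <= fine B by rewrite -lee_fin -Bfin.
  have b1 : 1 < fine B by apply: lt_le_trans b2; rewrite ltr1n.
  have z0 : 0 < mass alpha spin_zero.
    have : 0 < mass alpha spin_zero / (fine B - 1).
      by apply: le_lt_trans maxlt; rewrite le_max mass_ge0.
    by rewrite pmulr_lgt0 // invr_gt0 subr_gt0.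
  apply: le_lt_trans (_ : ((fine B * c)%:E < 1)%E); last first.
    by rewrite lte_fin; apply/opposite_dTV_lt1P.
  apply: dobrushin_constant_le => // i.
  by rewrite ler_wpM2r // -lee_fin -Bfin //; exact: degree_le_max_degree.
- have := sum_mass alpha; rewrite z1 addrAC => /(canRL (addrK _)).
  rewrite subrr => /eqP; rewrite paddr_eq0 ?mass_ge0 // => /andP[/eqP m0 /eqP p0].
  have z0 : 0 < mass alpha spin_zero by rewrite z1.
  have c0 : c = 0 by rewrite /c opposite_dTVE // m0 p0 !mul0r maxxx.
  apply: le_lt_trans (_ : (0%:E < 1)%E); last by rewrite lte_fin.
  by apply: dobrushin_constant_le => // i; rewrite -/c c0 mulr0.
Qed.
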